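(* Let $X$ be a continuum. The following conditions are equivalent: (a) $CC_1(X)=NC_1(X)$; (b) $CC_n(X)=NC_n(X)$ for some $n\in\mathbb N$; (c) $CC_n(X)=NC_n(X)$ for each $n\in\mathbb N$; (d) $\bigcup_{n=1}^\infty CC_n(X)=\bigcup_{n=1}^\infty NC_n(X)$; (e) $CC_{2^X}=\bigcup_{n=1}^\infty NC_n(X)$.
   Context: All spaces are metric; a continuum is a compact connected space with more than one point; $\mathbb N=\{1,2,\dots\}$. For a non-empty space $Y$ and $n\in\mathbb N$: $2^Y$ is the set of non-empty compact subsets of $Y$; $F_n(Y)$ is the set of elements of $2^Y$ with at most $n$ points. A non-empty space $Y$ is $n$-$Q1$ if there exists $B\in F_n(Y)$ such that for each $x\in Y$ there exists a continuum $D\subset Y$ with $x\in \mathrm{int}_Y(D)$ and $B\cap D\neq\emptyset$. For a continuum $X$: $CC_n(X)=\{A\in 2^X: A=X$ or $X-A$ is $n$-$Q1\}$; $NC_n(X)=\{A\in 2^X: X-A$ has at most $n$ components$\}$; $CC_{2^X}$ is the set of all $A\in 2^X$ such that either $A=X$, or there exists $B\in 2^X$ with $B\cap A=\emptyset$ such that for every $y\in X-A$ there exists a continuum $D\subset X-A$ with $y\in\mathrm{int}(D)$ and $D\cap B\neq\emptyset$. *)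

(* Defs.v *)
From HB Require Import structures.
From mathcomp Require Import all_boot all_order all_algebra.
From mathcomp Require Import all_classical all_reals all_analysis.

Set Implicit Arguments.
Unset Strict Implicit.
Unset Printing Implicit Defensive.

Local Open Scope classical_set_scope.
Local Open Scope card_scope.

(* Continua are nondegenerate. Compactness and connectedness are intrinsic, so
   the continua of a subspace Y are exactly the continua D `<=` Y of T. *)
Definition continuum {T : topologicalType} (D : set T) : Prop :=
  [/\ compact D, connected D & exists x y, [/\ D x, D y & x <> y]].

(* The hyperspace 2^Y of a subspace Y of T. *)
Definition hyperspace {T : topologicalType} (Y : set T) : set (set T) :=
  [set A | [/\ A !=set0, compact A & A `<=` Y]].

Definition Fn {T : topologicalType} (n : nat) (Y : set T) : set (set T) :=
  [set B | hyperspace Y B /\ B #<= `I_n].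

Definition n_Q1 {T : topologicalType} (n : nat) (Y : set T) : Prop :=
  Y !=set0 /\
  exists2 B, Fn n Y B &
    forall x, Y x ->
      exists D : set T,
        [/\ continuum D, D `<=` Y, @interior (subspace Y) D x
          & B `&` D !=set0].

Definition components {T : topologicalType} (Y : set T) : set (set T) :=
  [set connected_component Y x | x in Y].

Definition CC (X : topologicalType) (n : nat) : set (set X) :=
  [set A | hyperspace setT A /\ (A = setT \/ n_Q1 n (~` A))].
Arguments CC : clear implicits.

Definition NC (X : topologicalType) (n : nat) : set (set X) :=
  [set A | hyperspace setT A /\ components (~` A) #<= `I_n].
Arguments NC : clear implicits.

(* The family CC_{2^X}, in which finite sets B are replaced by compact ones. *)
Definition CC2X (X : topologicalType) : set (set X) :=
  [set A | hyperspace setT A /\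
    (A = setT \/
     exists B, [/\ hyperspace setT B, B `&` A = set0 &
       forall y, (~` A) y ->
         exists D : set X,
           [/\ continuum D, D `<=` ~` A, interior D y & D `&` B !=set0]])].
Arguments CC2X : clear implicits.

(* Main.v *)
Require Import Defs.
From HB Require Import structures.
From mathcomp Require Import all_boot all_order all_algebra.
From mathcomp Require Import all_classical all_reals all_analysis.

Set Implicit Arguments.
Unset Strict Implicit.
Unset Printing Implicit Defensive.

Local Open Scope classical_set_scope.

(** For every n one has [CC X n `<=` NC X n], and
    [\bigcup_n CC X n `<=` CC2X X `<=` \bigcup_n NC X n]
    ([CC_sub_NC], [CC_sub_CC2X], [CC2X_sub_NC]): if each point of [~` A] lies
    with a point of B in a continuum inside [~` A], then B meets every component
    of [~` A]; and since components are then neighborhoods of their points, a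
    compact B meets only finitely many of them.

    Conversely, what separates an element A of [NC X n] from [CC X n] is only a
    local condition, [has_continuum_nbhs (~` A)]: each point of the open set
    [~` A] is interior to a continuum lying in [~` A]. Under this condition,
    lying together in a subcontinuum of [~` A] is an equivalence relation with
    open classes, so any two points of one component lie in a common continuum
    ([component_joined_by_continuum]), and one point per component is a set B
    witnessing that A belongs to [CC X n] ([NC_continuum_nbhs_CC]).

    The five conditions are therefore all equivalent to the following one: the
    complement of every element of [NC X 1] satisfies the local condition. Each
    of them implies it, because elements of [CC X n] and of [CC2X X] satisfy
    the local condition, and [NC X 1] is included in [NC X n] for n > 0
    ([NC_continuum_nbhs_1]). For the converse, a component
    of an open set with finitely many components is open, hence is the
    complement of an element of [NC X 1]; so the local condition passes from
    connected open sets to open sets with finitely many components, and the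
    inclusions above become equalities ([NC1_continuum_nbhs_NC],
    [NC1_continuum_nbhs_eq]). *)

(** * Components of open sets *)

Section open_sets.
Local Open Scope card_scope.
Context {T : topologicalType}.
Implicit Types (A B C D U Y : set T).

(** A point of A, if there is one, serves as the base point that the covering
    characterization of compactness asks for. *)
Lemma compact_finite_subcover A : compact A -> cover_compact A.
Proof.
have [-> _ I D f _ _|/set0P[x0 _] cA] := eqVneq A set0.
  by exists finmap.fset0.
pose pT : ptopologicalType := HB.pack (T : Type) T (isPointed.Build T x0).
by have : @cover_compact pT A by rewrite -compact_cover.
Qed.

Lemma connected_between_closure C Y :
  C `<=` Y -> Y `<=` closure C -> connected C -> connected Y.
Proof.
move=> CY YC Cc B [y By] [V oV BV] [F cF BF].
(* The open set V meets Y, hence meets C, which is dense in Y. *)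
have CB : C `&` B = C.
  apply: Cc.
  - move: By; rewrite BV => -[Yy Vy].
    have [z [Cz Vz]] := YC y Yy V (open_nbhs_nbhs (conj oV Vy)).
    by exists z; split=> //; split=> //; apply: CY.
  - by exists V => //; rewrite BV setIA (setIidl CY).
  - by exists F => //; rewrite BF setIA (setIidl CY).
rewrite BF; apply/setIidl => z /YC.
rewrite [F in _ -> F z](closure_id F).1 //; apply: closureS => w.
by rewrite -CB BF => -[_ []].
Qed.

(** Representatives are chosen per component, so that B is no larger than the
    set of components; this turns a count of components into a bound on B. *)
Lemma component_representatives U :
  exists B, [/\ B `<=` U, B #<= components U &
    forall y, U y -> exists2 b, B b & connected_component U b y].
Proof.
have [-> | /set0P[x0 Ux0]] := eqVneq U set0.
  by exists set0; split=> //; exact: subset_card_le.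
pose rep E := xget x0 E.
have repP x : U x -> connected_component U x (rep (connected_component U x)).
  by move=> Ux; apply: (xgetPex x0); exists x; apply: connected_component_refl.
exists (rep @` components U); split.
- by move=> _ [_ [x Ux <-] <-]; apply: (connected_component_sub (repP x Ux)).
- exact: card_image_le.
- move=> y Uy; exists (rep (connected_component U y)).
    by exists (connected_component U y) => //; exists y.
  exact/connected_component_sym/repP.
Qed.

(** A component is relatively closed, since adding limit points keeps a set
    connected; it is thus the complement in U of the closures of the other
    components, and a finite union of closures is closed. *)
Lemma finite_components_open U x :
  open U -> finite_set (components U) -> open (connected_component U x).
Proof.
move=> oU finU; have [B [BU Bcard Bcov]] := component_representatives U.
have [Ux|nUx] := pselect (U x); last first.
  by rewrite connected_component_out //; exact: open0.
pose B' := B `\` connected_component U x.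
pose F := \bigcup_(b in B') closure (connected_component U b).
suff -> : connected_component U x = U `&` ~` F.
  apply: openI => //; apply: closed_openC; apply: closed_bigcup.
    by apply: (@sub_finite_set _ _ B); [exact: subDsetl|exact: card_le_finite finU].
  by move=> b _; exact: closed_closure.
apply/seteqP; split=> y.
  move=> xy; split; first exact: connected_component_sub xy.
  move=> [b [Bb nxb] cly]; apply: nxb.
  apply: (connected_component_trans xy); apply: connected_component_sym.
  (* M extends the component of b by its limit points in U, among them y. *)
  pose M := U `&` closure (connected_component U b).
  have sM : connected_component U b `<=` M.
    move=> z bz; split; first exact: connected_component_sub bz.
    exact: subset_closure.
  exists M; last by split=> //; exact: connected_component_sub xy.
  split.
  - by apply: sM; apply: connected_component_refl; exact: BU.
  - exact: subIsetl.
  - apply: (connected_between_closure sM); first exact: subIsetr.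
    exact: component_connected.
case=> Uy nFy; have [b Bb by_] := Bcov y Uy.
have [xb|nxb] := pselect (connected_component U x b).
  exact: connected_component_trans xb by_.
by exfalso; apply: nFy; exists b => //; exact: subset_closure.
Qed.

Lemma components_card_le U B :
  (forall y, U y -> exists2 b, B b & connected_component U b y) ->
  components U #<= B.
Proof.
move=> Bcov; apply: (card_le_trans _ (card_image_le (connected_component U) B)).
apply: subset_card_le => _ [y Uy <-]; have [b Bb by_] := Bcov y Uy.
by exists b => //; exact: same_connected_component.
Qed.

(** * Interior continua *)

Definition has_continuum_nbhs U : Prop :=
  forall x, U x -> exists D, [/\ continuum D, D `<=` U & interior D x].

Lemma continuumU D E :
  D `&` E !=set0 -> continuum D -> continuum E -> continuum (D `|` E).
Proof.
move=> DE [cD kD [x [y [Dx Dy xy]]]] [cE kE _]; split.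
- exact: compactU.
- exact: connectedU.
- by exists x, y; split=> //; left.
Qed.

Lemma continuum_component U D x y :
  continuum D -> D `<=` U -> D x -> D y -> connected_component U x y.
Proof. by move=> [_ kD _] DU Dx Dy; exists D. Qed.

(** The points that some continuum inside U joins to x form an open set whose
    complement in U is open too: a continuum inside U can be glued to any
    continuum joining one of its points to x, so it lies entirely in one of the
    two sets. A connected subset of U containing x therefore cannot leave the
    first one. *)
Lemma component_joined_by_continuum U x y :
  has_continuum_nbhs U -> connected_component U x y ->
  exists D, [/\ continuum D, D `<=` U, D x & D y].
Proof.
move=> cnU [B [Bx BU kB] By].
pose E := [set z | exists D, [/\ continuum D, D `<=` U, D x & D z]].
have EU : E `<=` U by move=> z [D [_ DU _]]; apply: DU.
have glue z w D : continuum D -> D `<=` U -> D z -> D w -> E z -> E w.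
  move=> cD DU Dz Dw [D' [cD' DU' Dx Dz']]; exists (D' `|` D); split.
  - by apply: continuumU => //; exists z.
  - by rewrite subUset.
  - by left.
  - by right.
have oE : open E.
  rewrite openE => z Ez; have [D [cD DU iDz]] := cnU z (EU z Ez).
  have Dz : D z := interior_subset iDz.
  by apply: filterS iDz => w Dw; exact: (glue z w D).
have oUE : open (U `\` E).
  rewrite openE => z [Uz nEz]; have [D [cD DU iDz]] := cnU z Uz.
  have Dz : D z := interior_subset iDz.
  apply: filterS iDz => w Dw; split; first exact: DU.
  by move=> Ew; apply: nEz; exact: (glue w z D).
have BE : B `&` E = B.
  apply: kB; last 2 first.
  - by exists E.
  - exists (~` (U `\` E)); first exact: open_closedC.
    apply/seteqP; split=> z [Bz Ez]; split=> //.
      by move=> [].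
    by apply: contrapT => nEz; apply: Ez; split=> //; exact: BU.
  exists x; split=> //; have [D [cD DU Dx]] := cnU x (BU x Bx).
  by exists D; split=> //; exact: nbhs_singleton.
by move: By; rewrite -BE => -[].
Qed.

(** This reconciles the interior relative to the complement of A in the
    definition of [n_Q1] with the interior in X. *)
Lemma interior_open_subspace U D x :
  open U -> U x -> @interior (subspace U) D x = interior D x.
Proof.
move=> oU Ux; rewrite /interior /=.
by rewrite -(@nbhs_subspace_interior _ U x) //; exact: open_nbhs_nbhs.
Qed.

End open_sets.

(** * The inclusions that always hold *)

Section continuum.
Local Open Scope card_scope.
Context {R : realType} {X : metricType R}.
Context (cX : compact [set: X]).
Implicit Types (A B : set X) (n : nat).

Local Notation finite_NC := (\bigcup_(n in [set n : nat | (0 < n)%N]) NC X n).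

Lemma hyperspace_open A : hyperspace setT A -> open (~` A).
Proof.
by case=> _ cA _; apply: closed_openC; apply: compact_closed => //;
   exact: metric_hausdorff.
Qed.

Lemma finite_componentsP A :
  finite_NC A <-> hyperspace setT A /\ finite_set (components (~` A)).
Proof.
split=> [[n _ [hA cA]]|[hA /finite_set_leP[n cA]]].
  by split=> //; apply/finite_set_leP; exists n.
(* The bound n may be 0, but the union ranges over positive bounds. *)
exists n.+1 => //; split=> //; apply: card_le_trans cA _.
by apply: subset_card_le => i /= /ltnW.
Qed.

Lemma CC_sub_NC n : CC X n `<=` NC X n.
Proof.
move=> A [hA HA]; split=> //; case: HA => [->|[_ [B [_ Bn] HB]]].
  by rewrite setCT /components image_set0; exact: card_ge0.
apply: card_le_trans Bn; apply: components_card_le => y Ay.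
have [D [cD DA iD [b [Bb Db]]]] := HB y Ay; exists b => //.
apply: (continuum_component cD DA Db); move: iD.
by rewrite interior_open_subspace //; [exact: interior_subset|exact: hyperspace_open].
Qed.

Lemma CC_sub_CC2X n : CC X n `<=` CC2X X.
Proof.
move=> A [hA [AT|[_ [B [[B0 cB BA] _] HB]]]]; split=> //; first by left.
right; exists B; split=> //; first by apply/disjoints_subset.
move=> y Ay; have [D [cD DA iD BD]] := HB y Ay; exists D; split=> //.
  by move: iD; rewrite interior_open_subspace //; exact: hyperspace_open.
by rewrite setIC.
Qed.

Lemma CC2X_continuum_nbhs A : CC2X X A -> has_continuum_nbhs (~` A).
Proof.
case=> _ [->|[B [_ _ HB]] y Ay]; first by rewrite setCT.
by have [D [? ? ? _]] := HB y Ay; exists D.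
Qed.

(** Every component of [~` A] is a neighborhood of its points, so finitely many
    components already cover the compact set B; one point in each of them then
    plays the role of B. *)
Lemma CC2X_sub_NC : CC2X X `<=` finite_NC.
Proof.
move=> A HA; have cnA := CC2X_continuum_nbhs HA.
case: HA => hA HA; apply/finite_componentsP; split=> //.
case: HA => [->|[B [[_ cB _] /disjoints_subset BA HB]]].
  by rewrite setCT /components image_set0.
have [] := compact_finite_subcover cB (D := ~` A)
    (f := fun x => interior (connected_component (~` A) x)).
- by move=> x _; exact: open_interior.
- move=> x /BA Ax; exists x => //; have [D [cD DA iDx]] := cnA x Ax.
  have Dx : D x := interior_subset iDx.
  by apply: filterS iDx => y Dy; exact: (continuum_component cD DA).
move=> B' B'A Bcov; apply: card_le_finite (finite_fset B').
apply: components_card_le => y Ay; have [D [cD DA Dy [b [Db Bb]]]] := HB y Ay.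
have [i B'i /interior_subset ib] := Bcov b Bb; exists i => //.
apply: (connected_component_trans ib); apply: (continuum_component cD DA Db).
exact: interior_subset Dy.
Qed.

(** * Open sets with finitely many components *)

(** One point per component suffices for B: a continuum around y, glued to a
    continuum joining y to the representative of its component, meets B. *)
Lemma NC_continuum_nbhs_CC n A :
  NC X n A -> has_continuum_nbhs (~` A) -> CC X n A.
Proof.
move=> [hA cA] cnA; split=> //.
have [AT|/set0P[x Ax]] := eqVneq (~` A) set0.
  by left; rewrite -(setCK A) AT setC0.
have [B [BA Bcard Bcov]] := component_representatives (~` A).
have Bn : B #<= `I_n := card_le_trans Bcard cA.
right; split; first by exists x.
exists B; first split=> //.
  split=> //; first by have [b Bb _] := Bcov x Ax; exists b.
  by apply: finite_compact; apply/finite_set_leP; exists n.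
move=> y Ay; have [b Bb by_] := Bcov y Ay.
have [D [cD DA Db Dy]] := component_joined_by_continuum cnA by_.
have [E [cE EA iE]] := cnA y Ay; exists (E `|` D); split.
- by apply: continuumU => //; exists y; split=> //; exact: nbhs_singleton.
- by rewrite subUset.
- rewrite interior_open_subspace //; last exact: hyperspace_open.
  by apply: filterS iE => z Ez; left.
- by exists b; split=> //; right.
Qed.

(** The component C of x in [~` A] is open, and X is compact, so [~` C] is
    itself an element of [NC X 1]; a continuum around x inside C is in
    particular inside [~` A]. *)
Lemma NC1_continuum_nbhs_NC :
  (forall A, NC X 1 A -> has_continuum_nbhs (~` A)) ->
  forall A, finite_NC A -> has_continuum_nbhs (~` A).
Proof.
move=> H A /finite_componentsP[hA finA] x Ax.
pose C := connected_component (~` A) x.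
have oC : open C by apply: finite_components_open => //; exact: hyperspace_open.
have Cx : C x by exact: connected_component_refl.
have CA : C `<=` ~` A by exact: connected_component_sub.
have NC1 : NC X 1 (~` C).
  split.
    split=> //.
      by case: hA => -[a Aa] _ _; exists a => /CA; apply.
    apply: (@subclosed_compact _ _ setT) => //; exact: open_closedC.
  have x1 : [set x] #= `I_1 by exact: card_set1.
  rewrite setCK -(card_le_eqr x1).
  apply: components_card_le => y Cy; exists x => //.
  exists C => //; split=> //; exact: component_connected.
have := H _ NC1; rewrite setCK => /(_ x Cx)[D [cD DC Dx]].
by exists D; split=> //; exact: subset_trans DC CA.
Qed.

Lemma NC1_continuum_nbhs_eq n : (0 < n)%N ->
  (forall A, NC X 1 A -> has_continuum_nbhs (~` A)) -> CC X n = NC X n.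
Proof.
move=> n0 H; apply/seteqP; split; first exact: CC_sub_NC.
move=> A HA; apply: NC_continuum_nbhs_CC => //.
by apply: NC1_continuum_nbhs_NC => //; exists n.
Qed.

(** As [NC X 1] is included in [NC X n], the inclusion for a single n suffices:
    this is why an equality for some n entails the equality for all n. *)
Lemma NC_continuum_nbhs_1 n : (0 < n)%N -> NC X n `<=` CC2X X ->
  forall A, NC X 1 A -> has_continuum_nbhs (~` A).
Proof.
move=> n0 H A [hA cA]; apply: CC2X_continuum_nbhs; apply: H; split=> //.
by apply: card_le_trans cA _; apply: subset_card_le => i /= /leq_trans; apply.
Qed.

End continuum.

Theorem corollary3p15 (R : realType) (X : metricType R)
    (hX : continuum [set: X]) :
  [<-> CC X 1 = NC X 1;
       exists2 n : nat, (0 < n)%N & CC X n = NC X n;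
       forall n : nat, (0 < n)%N -> CC X n = NC X n;
       \bigcup_(n in [set n : nat | (0 < n)%N]) CC X n =
         \bigcup_(n in [set n : nat | (0 < n)%N]) NC X n;
       CC2X X = \bigcup_(n in [set n : nat | (0 < n)%N]) NC X n].
Proof.
have cX : compact [set: X] by case: hX.
tfae.
- by exists 1%N.
- move=> [m m0 Hm] n n0; apply: NC1_continuum_nbhs_eq => //.
  by apply: (NC_continuum_nbhs_1 m0); rewrite -Hm; exact: CC_sub_CC2X.
- by move=> H; apply: eq_bigcupr => n n0; exact: H.
- move=> H; apply/seteqP; split; first exact: CC2X_sub_NC.
  by rewrite -H => A [n _]; exact: CC_sub_CC2X.
- move=> H; apply: NC1_continuum_nbhs_eq => //.
  by apply: (@NC_continuum_nbhs_1 _ _ 1) => //; rewrite H => A HA; exists 1%N.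
Qed.
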